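(* Let $\mathcal{T}=(\mathcal{V},\mathcal{E})$ be a tree with $\mathcal{V}=\{1,\dots,d\}$, let $(\boldsymbol{\lambda},\boldsymbol{\alpha})$ be admissible parameters, and let $\boldsymbol{N}=(N_v)_{v\in\mathcal{V}}\sim\mathrm{MPMRF}(\boldsymbol{\lambda},\boldsymbol{\alpha},\mathcal{T})$. For $v\in\mathcal{V}$ let $\Theta_v$ be the set of all vertex sets of subtrees of $\mathcal{T}$ containing $v$, i.e. all $\mathcal{W}\subseteq\mathcal{V}$ with $v\in\mathcal{W}$ such that for all $i,j\in\mathcal{W}$, every vertex on the path from $i$ to $j$ in $\mathcal{T}$ belongs to $\mathcal{W}$. Then $\boldsymbol{N}$ admits the stochastic representation (i.e. has the same joint distribution as the vector given by) $$N_v=\sum_{\mathcal{W}\in\Theta_v}Y_{\mathcal{W}},\qquad v\in\mathcal{V},$$ where $\{Y_{\mathcal{W}}:\mathcal{W}\in\bigcup_{v\in\mathcal{V}}\Theta_v\}$ are independent Poisson random variables with respective parameters $$\gamma_{\mathcal{W}}=\Big(\prod_{w\in\mathcal{W}}\lambda_w\Big)\Big(\prod_{(i,j)\in\mathcal{E}_{\mathcal{W}}}\frac{\alpha_{(i,j)}}{\sqrt{\lambda_i\lambda_j}}\Big)\Big(\prod_{(i,j)\in\mathcal{E}_{\mathcal{W}}^{\dagger}}\Big(1-\alpha_{(i,j)}\sqrt{\lambda_j/\lambda_i}\Big)\Big),$$ with $\mathcal{E}_{\mathcal{W}}=\{(i,j)\in\mathcal{E}:i,j\in\mathcal{W}\}$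 (each undirected edge counted once) and $\mathcal{E}_{\mathcal{W}}^{\dagger}=\{(i,j)\in\mathcal{E}:i\in\mathcal{W},\,j\notin\mathcal{W}\}$ (edges with exactly one endpoint in $\mathcal{W}$, written with the endpoint in $\mathcal{W}$ first).
   Context: Edges are undirected, so $\alpha_{(u,v)}=\alpha_{(v,u)}$. Parameters $(\boldsymbol{\lambda},\boldsymbol{\alpha})$, with $\boldsymbol{\lambda}=(\lambda_v)_{v\in\mathcal{V}}$ and $\boldsymbol{\alpha}=(\alpha_e)_{e\in\mathcal{E}}$, are admissible if $\lambda_v>0$ for all $v$ and $0<\alpha_{(u,v)}\le\min(\sqrt{\lambda_u/\lambda_v},\sqrt{\lambda_v/\lambda_u})$ for every edge $(u,v)$. Binomial thinning: for an $\mathbb{N}$-valued $Y$ and $\theta\in[0,1]$, $\theta\circ Y:=\sum_{j=1}^{Y}I_j^{(\theta)}$ with $(I_j^{(\theta)})_{j\ge1}$ i.i.d. Bernoulli($\theta$), independent of $Y$. $\boldsymbol{N}\sim\mathrm{MPMRF}(\boldsymbol{\lambda},\boldsymbol{\alpha},\mathcal{T})$ means: for a choice of root $r\in\mathcal{V}$ (the resulting law does not depend on the choice), with $\mathrm{pa}(v)$ the parent of $v$ in $\mathcal{T}$ rooted at $r$, $N_r=L_r$ and $N_v=\big(\alpha_{(\mathrm{pa}(v),v)}\sqrt{\lambda_v/\lambda_{\mathrm{pa}(v)}}\big)\circ N_{\mathrm{pa}(v)}+L_v$ for $v\ne r$, where the $L_v$ are independent, $L_r\sim\mathrm{Poisson}(\lambda_r)$,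 $L_v\sim\mathrm{Poisson}\big(\lambda_v(1-\alpha_{(\mathrm{pa}(v),v)}\sqrt{\lambda_{\mathrm{pa}(v)}/\lambda_v})\big)$ for $v\neq r$, and the Bernoulli sequences used in the thinnings are mutually independent and independent of $(L_v)_{v\in\mathcal{V}}$. A Poisson distribution with parameter $0$ is the point mass at $0$; empty products equal $1$. *)

(* Defs.v *)
From mathcomp Require Export all_boot all_order all_algebra.
From mathcomp Require Export finmap.
From mathcomp Require Export all_classical all_reals all_analysis.

Set Implicit Arguments.
Unset Strict Implicit.
Unset Printing Implicit Defensive.

Import Order.TTheory GRing.Theory Num.Theory.

Local Open Scope ring_scope.

(* A graph on the vertex set {1, ..., d} is a relation e on 'I_d (numbered      *)
(* from 0).                                                                     *)
Section Graph.
Context (d : nat) (e : rel 'I_d).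
Implicit Types (r u v i j : 'I_d) (W : {set 'I_d}) (p : seq 'I_d).

(* An edge {x, y} of a simple graph gives the closed walk [:: x; y], so acyclic *)
(* means that there is no simple cycle on three or more vertices.               *)
Definition is_tree : Prop :=
  [/\ (0 < d)%N, symmetric e, irreflexive e,
      (forall u v, connect e u v) &
      (forall c : seq 'I_d, ucycle e c -> (size c <= 2)%N)].

Definition simple_path i p j : Prop :=
  [/\ path e i p, uniq (i :: p) & last i p = j].

(* u = pa(v) when the tree is rooted at r. *)
Definition is_parent r v u : Prop := exists p, simple_path v (u :: p) r.

Definition path_closed W : Prop :=
  forall i j p, i \in W -> j \in W -> simple_path i p j -> {subset p <= W}.

Definition Theta v : {set {set 'I_d}} :=
  [set W : {set 'I_d} | (v \in W) && `[< path_closed W >]].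

Definition subtrees : {set {set 'I_d}} := \bigcup_(v : 'I_d) Theta v.

(* i < j selects one orientation of each undirected edge. *)
Definition inner_edges W : {set 'I_d * 'I_d} :=
  [set ij : 'I_d * 'I_d |
    [&& e ij.1 ij.2, ij.1 \in W, ij.2 \in W & (ij.1 < ij.2)%N]].

Definition boundary_edges W : {set 'I_d * 'I_d} :=
  [set ij : 'I_d * 'I_d | [&& e ij.1 ij.2, ij.1 \in W & ij.2 \notin W]].

End Graph.

Section Weights.
Context (R : realType) (d : nat) (e : rel 'I_d).
Context (lambda : 'I_d -> R) (alpha : 'I_d -> 'I_d -> R).

Definition admissible : Prop :=
  [/\ (forall v, 0 < lambda v),
      (forall u v, e u v -> alpha u v = alpha v u) &
      (forall u v, e u v ->
         0 < alpha u v <= Num.min (Num.sqrt (lambda u / lambda v))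
                                  (Num.sqrt (lambda v / lambda u)))].

Definition gamma (W : {set 'I_d}) : R :=
  (\prod_(w in W) lambda w)
  * (\prod_(ij in inner_edges e W)
       (alpha ij.1 ij.2 / Num.sqrt (lambda ij.1 * lambda ij.2)))
  * (\prod_(ij in boundary_edges e W)
       (1 - alpha ij.1 ij.2 * Num.sqrt (lambda ij.2 / lambda ij.1))).

End Weights.

Section Probability.
Context (R : realType) (disp : measure_display) (T : measurableType disp).
Context (P : probability T R).

(* Outside its parameter range, poisson_prob (resp. bernoulli_prob) is the      *)
(* point mass at 0 (resp. false), hence the range conditions below.             *)
(* poisson_prob 0 is the point mass at 0; the second argument of poisson_prob   *)
(* is a dummy.                                                                  *)
Definition poisson_distributed (X : {RV P >-> nat}) (rate : R) : Prop :=
  0 <= rate /\ forall U : set nat, distribution P X U = poisson_prob rate 0%N U.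

Definition bernoulli_distributed (X : {RV P >-> bool}) (theta : R) : Prop :=
  0 <= theta <= 1 /\
  forall U : set bool, distribution P X U = bernoulli_prob theta U.

(* Mutual independence of the nat-valued family (X i), i in D; every subset of  *)
(* nat is measurable.                                                           *)
Definition mutually_independent (I : choiceType) (D : set I)
    (X : I -> T -> nat) : Prop :=
  forall (J : {fset I}) (A : I -> set nat),
    ([set` J] `<=` D)%classic ->
    P (\bigcap_(i in [set` J]) (X i @^-1` A i))%classic
    = (\prod_(i <- J) P (X i @^-1` A i)%classic)%E.

Definition thinning (B : nat -> T -> bool) (Y : T -> nat) : T -> nat :=
  fun t => (\sum_(j < Y t) B j t)%N.

End Probability.

(* Equality of joint laws. Since nat ^ d is countable, all its subsets belong   *)
(* to the product sigma-algebra.                                                *)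
Definition same_law (R : realType) (d : nat)
    (disp : measure_display) (T : measurableType disp) (P : probability T R)
    (N : 'I_d -> T -> nat)
    (disp' : measure_display) (T' : measurableType disp')
    (P' : probability T' R) (N' : 'I_d -> T' -> nat) : Prop :=
  forall A : set ('I_d -> nat),
    P [set t | A (fun v => N v t)]%classic
    = P' [set t | A (fun v => N' v t)]%classic.

Section MPMRF.
Context (R : realType) (d : nat) (e : rel 'I_d).
Context (lambda : 'I_d -> R) (alpha : 'I_d -> 'I_d -> R).

(* N is built from the root r with innovations L and Bernoulli sequences B v    *)
(* (v != r), which thin N_pa(v). The variables L and B are put in a single      *)
(* nat-valued family, with true and false sent to 1 and 0.                      *)
Definition MPMRF_construction (disp : measure_display)
    (T : measurableType disp) (P : probability T R) (r : 'I_d)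
    (L : 'I_d -> {RV P >-> nat}) (B : 'I_d -> nat -> {RV P >-> bool})
    (N : 'I_d -> T -> nat) : Prop :=
  [/\ mutually_independent P
        (fun k : 'I_d + 'I_d * nat =>
           match k with inl _ => True | inr (v, _) => v != r end)
        (fun k t => match k with inl v => L v t | inr (v, j) => B v j t : nat end),
      poisson_distributed (L r) (lambda r),
      N r = L r &
      forall v u, is_parent e r v u ->
        [/\ poisson_distributed (L v)
              (lambda v * (1 - alpha u v * Num.sqrt (lambda u / lambda v))),
            (forall j, bernoulli_distributed (B v j)
               (alpha u v * Num.sqrt (lambda v / lambda u))) &
            forall t, N v t = (thinning (B v) (N u) t + L v t)%N]].

Definition is_MPMRF (disp : measure_display) (T : measurableType disp)
    (P : probability T R) (N : 'I_d -> {RV P >-> nat}) : Prop :=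
  exists (r : 'I_d) (disp' : measure_display) (T' : measurableType disp')
    (P' : probability T' R) (L : 'I_d -> {RV P' >-> nat})
    (B : 'I_d -> nat -> {RV P' >-> bool}) (N' : 'I_d -> T' -> nat),
    MPMRF_construction r L B N' /\ same_law P N P' N'.

(* Only the Y W with W in subtrees e matter.                                    *)
Definition poisson_family (disp : measure_display) (T : measurableType disp)
    (P : probability T R) (Y : {set 'I_d} -> {RV P >-> nat}) : Prop :=
  mutually_independent P [set` subtrees e]%classic
    (fun W => Y W : T -> nat) /\
  forall W, W \in subtrees e ->
    poisson_distributed (Y W) (gamma e lambda alpha W).

Definition subtree_sum (T : Type) (Y : {set 'I_d} -> T -> nat) (v : 'I_d) :
    T -> nat :=
  fun t => (\sum_(W in Theta e v) Y W t)%N.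

End MPMRF.

(* Main.v *)
From HB Require Import structures.
Require Import Defs.
From mathcomp Require Import zify ring.

(* The tree is grown from the root one vertex at a time. Let v be a vertex    *)
(* outside the current subtree S, attached to u in S, and let theta be the    *)
(* thinning parameter of the edge (u, v). If N_w is the sum of the Y_W, W     *)
(* containing w, over the subtrees W of S, then thinning N_u amounts to       *)
(* thinning each Y_W with u in W separately, and a Poisson variable splits    *)
(* into two independent ones: the unmarked part keeps the index W, with rate  *)
(* multiplied by 1 - theta, and the marked part gets the index W + v, with    *)
(* rate multiplied by theta. Together with the innovation at v, indexed by    *)
(* {v}, these are the subtrees of S + v, with the rates gamma computed in     *)
(* S + v. All of this is done on point probabilities, which are finite sums;  *)
(* the splitting step is the Vandermonde identity for binomial weights.       *)

Set Implicit Arguments.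
Unset Strict Implicit.
Unset Printing Implicit Defensive.

Import Order.TTheory GRing.Theory Num.Theory.

Local Open Scope ring_scope.

(** * Finite convolutions of count vectors *)

(** The law of a count vector is determined by its atoms ([same_law_atoms]), and an atom of a vector
    of sums of independent counts is a finite [convolution] ([probability_sum_event]). The event N =
    n of the construction is of this kind: once N_u = [n u] is imposed, thinning at a child v of u
    only adds up the first [n u] Bernoulli variables at v. Apart from the Poisson innovation at v,
    common to both sides, attaching v inserts a binomial weight into the convolution of the
    innovations ([convolution_bernoulli]), and splitting the Poisson family inserts the same weight
    ([poisson_convolution_split]). The resulting index sets and rates are those of the larger tree
    ([subtrees_grow], [gamma_in_grow]), because v has a single neighbour in S. Induction along
    [tree_growth] yields [pmf_construction], whose right-hand side is also the atom of the subtree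
    sums ([pmf_subtree_sum]). Product measures supply the Poisson family
    ([independent_poisson_exists]). *)

Section Convolution.
Context (R : realType) (d B : nat).
Implicit Types (n : 'I_d -> nat) (W : {set 'I_d}) (u v : 'I_d).

Definition fits n W k : bool := [forall w in W, (k <= n w)%N].

(** The subtraction is truncated; it is the true difference under the guard [fits n W k] carried by
    each summand of [convolution]. *)
Definition lower n W k : 'I_d -> nat := fun v => (n v - (v \in W) * k)%N.

Definition kill n v : 'I_d -> nat := fun w => if w == v then 0%N else n w.

(* The probability that the sum over c in s of X_c times the indicator vector
   of c.1 equals n, for independent X_c with point probabilities c.2. The bound
   B only makes the sum finite; it is harmless when n < B and every c.1 is
   nonempty. *)
Fixpoint convolution (s : seq ({set 'I_d} * (nat -> R))) n : R :=
  if s is c :: s' then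
    \sum_(k < B | fits n c.1 k) c.2 k * convolution s' (lower n c.1 k)
  else [forall v, n v == 0%N]%:R.

(** Binomial point probability, encoded as a coefficient of the generating polynomial so that the
    Vandermonde identity is the coefficient formula for a product. *)
Definition bin_weight (theta : R) (m k : nat) : R :=
  (((1 - theta)%:P + theta *: 'X) ^+ m)`_k.

(** At rate 0 the convention 0 ^+ 0 = 1 makes this the point mass at 0. *)
Definition poisson_weight (rate : R) (k : nat) : R :=
  rate ^+ k / k`!%:R * expR (- rate).

Lemma kill_id n v : n v = 0%N -> kill n v = n.
Proof. by move=> nv; apply: funext => w; rewrite /kill; case: eqP => // ->. Qed.

Lemma fits_kill n W v k : v \notin W -> fits (kill n v) W k = fits n W k.
Proof.
move=> vW; apply: eq_forallb_in => w wW; rewrite /kill.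
by case: eqP wW vW => // -> ->.
Qed.

Lemma kill_lower n W v k : kill (lower n W k) v = lower (kill n v) W k.
Proof. by apply: funext => w; rewrite /kill /lower; case: eqP. Qed.

Lemma kill_lowerU n W v k :
  kill (lower n (v |: W) k) v = lower (kill n v) W k.
Proof.
apply: funext => w; rewrite /kill /lower in_setU1.
by case: eqP.
Qed.

Lemma lowerD n W j k : lower (lower n W j) W k = lower n W (j + k)%N.
Proof. by apply: funext => w; rewrite /lower -subnDA mulnDr. Qed.

Lemma fits_set1 n v k : fits n [set v] k = (k <= n v)%N.
Proof.
apply/forall_inP/idP => [|kn w]; first by apply; rewrite set11.
by rewrite inE => /eqP ->.
Qed.

Lemma fitsU1 n W v k : fits n (v |: W) k = (k <= n v)%N && fits n W k.
Proof.
apply/forall_inP/andP => [h|[kv /forall_inP h] w].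
  split; first by apply: h; rewrite setU11.
  by apply/forall_inP => w wW; apply: h; rewrite setU1r.
by rewrite in_setU1 => /orP[/eqP ->//|]; exact: h.
Qed.

Lemma fits_lower n W j k : fits n W j ->
  fits (lower n W j) W k = fits n W (j + k)%N.
Proof.
move=> /forall_inP fj; apply: eq_forallb_in => w wW.
by rewrite /lower wW mul1n leq_subRL ?fj.
Qed.

Lemma fits_le n W j k : (j <= k)%N -> fits n W k -> fits n W j.
Proof.
move=> jk /forall_inP h; apply/forall_inP => w wW.
by rewrite (leq_trans jk) ?h.
Qed.

Lemma bin_weight0 theta k : bin_weight theta 0 k = (k == 0%N)%:R.
Proof. by rewrite /bin_weight expr0 coef1. Qed.

Lemma bin_weightD theta l m k :
  bin_weight theta (l + m) k =
  \sum_(j < k.+1) bin_weight theta l j * bin_weight theta m (k - j).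
Proof. by rewrite /bin_weight exprD coefM. Qed.

Lemma bin_weight_oversize theta m k : (m < k)%N -> bin_weight theta m k = 0.
Proof.
move=> mk; rewrite /bin_weight nth_default//.
apply: leq_trans mk; elim: m => [|m ih]; first by rewrite expr0 size_poly1.
rewrite exprS; apply: leq_trans (size_polyMleq _ _) _.
have h : (size ((1 - theta)%:P + theta *: 'X)%R <= 2)%N.
  apply: leq_trans (size_polyD _ _) _; rewrite geq_max.
  rewrite (leq_trans (size_polyC_leq1 _))//=.
  by rewrite (leq_trans (size_scale_leq _ _))// size_polyX.
have predD a b : (a <= 2 -> b <= m.+1 -> (a + b).-1 <= m.+2)%N by lia.
exact: predD.
Qed.

Lemma bin_weightE theta m k : (k <= m)%N ->
  bin_weight theta m k = 'C(m, k)%:R * theta ^+ k * (1 - theta) ^+ (m - k).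
Proof.
move=> km; rewrite /bin_weight exprDn coef_sum.
rewrite (bigD1 (Ordinal (km : k < m.+1)%N))//= big1 ?addr0.
  rewrite coefMn -polyC_exp exprZn coefCM coefZ coefXn eqxx mulr1 -mulr_natl.
  ring.
move=> i /eqP ik; rewrite coefMn -polyC_exp exprZn coefCM coefZ coefXn.
case: eqP => [ki|]; last by rewrite !mulr0 mul0rn.
by case: ik; apply: val_inj => /=; lia.
Qed.

(** Marking each of the [k] points independently with probability [theta] leaves two independent
    Poisson counts: the exponentials multiply, and k! = C(k, j) j! (k - j)!. *)
Lemma poisson_splitting theta rate k j : (j <= k)%N ->
  poisson_weight ((1 - theta) * rate) (k - j) * poisson_weight (theta * rate) j
  = poisson_weight rate k * bin_weight theta k j.
Proof.
move=> jk; rewrite bin_weightE// /poisson_weight.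
have -> : expR (- rate) =
    expR (- ((1 - theta) * rate)) * expR (- (theta * rate)).
  by rewrite -expRD; congr expR; ring.
have -> : rate ^+ k = rate ^+ (k - j) * rate ^+ j.
  by rewrite -exprD subnK.
rewrite !exprMn -(bin_fact jk) !natrM.
have fk i : (i`!%:R : R) != 0 by rewrite pnatr_eq0 -lt0n fact_gt0.
have bk : ('C(k, j)%:R : R) != 0 by rewrite pnatr_eq0 -lt0n bin_gt0.
by field; rewrite !fk bk.
Qed.

(** Change of variables k = a + b, j = b. The pairs of the square with a + b at least [B] contribute
    nothing. *)
Lemma sum_antidiagonal (F : nat -> nat -> R) :
  (forall a b, (B <= a + b)%N -> F a b = 0) ->
  \sum_(a < B) \sum_(b < B) F a b =
  \sum_(k < B) \sum_(j < k.+1) F (k - j)%N j.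
Proof.
move=> F0.
transitivity (\sum_(b < B) \sum_(k < B | (b <= k)%N) F (k - b)%N b).
  rewrite exchange_big/=; apply: eq_bigr => b _.
  rewrite -(big_mkord xpredT (fun a => F a b)).
  rewrite -(big_mkord (fun k => (b <= k)%N) (fun k => F (k - b)%N b)).
  rewrite (big_cat_nat (n := B - b)) ?leq_subr//= [X in _ + X]big_nat_cond.
  rewrite [X in _ + X]big1 ?addr0; last by move=> i hi; apply: F0; lia.
  rewrite (big_cat_nat (n := b) (p := B)) ?(ltnW (ltn_ord b))//=.
  rewrite [X in _ = X + _]big_nat_cond [X in _ = X + _]big1 ?add0r; last first.
    by move=> i; lia.
  rewrite -[in RHS](add0n (b : nat)) big_addn.
  rewrite big_nat_cond [RHS]big_nat_cond.
  by apply: eq_big => i; rewrite ?add0n ?addnK ?leq_addl// andbT.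
rewrite (exchange_big_dep xpredT)//=; apply: eq_bigr => k _.
rewrite -(big_mkord (fun b => (b <= k)%N) (fun b => F (k - b)%N b)).
rewrite -(big_mkord xpredT (fun b => F (k - b)%N b)).
have kB := ltn_ord k.
rewrite [LHS](big_cat_nat (n := k.+1))//=.
rewrite [X in _ + X = _]big_nat_cond [X in _ + X = _]big1 ?addr0; last first.
  by move=> i; lia.
rewrite big_nat_cond [RHS]big_nat_cond; apply: eq_bigl => i; lia.
Qed.

(** No set of the family lowers the coordinate [v], so it reaches the base case unchanged and has to
    vanish there. *)
Lemma convolution_untouched (s : seq ({set 'I_d} * (nat -> R))) n v :
  (forall W, W \in map fst s -> v \notin W) ->
  convolution s n = (n v == 0%N)%:R * convolution s (kill n v).
Proof.
elim: s n => [n _|c s ih n vs] /=.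
  case: eqP => nv; first by rewrite kill_id// mul1r.
  by rewrite mul0r; case: forallP => // /(_ v) /eqP.
have vc : v \notin c.1 by apply: vs; rewrite mem_head.
rewrite mulr_sumr; apply: eq_big => [k|k _]; first by rewrite fits_kill.
rewrite ih; last by move=> c' c's; apply: vs; rewrite inE c's orbT.
rewrite kill_lower {1}/lower (negbTE vc) mul0n subn0.
by rewrite mulrCA.
Qed.

(** The [m] Bernoulli variables act on the coordinate [v] alone, where their sum is binomial, while
    [s] does not see [v]. *)
Lemma convolution_bernoulli (s : seq ({set 'I_d} * (nat -> R))) n v f theta m :
  (n v < B)%N ->
  (forall c, c \in map fst s -> v \notin c) ->
  f 0%N = 1 - theta -> f 1%N = theta -> (forall k, (1 < k)%N -> f k = 0) ->
  convolution (nseq m ([set v], f) ++ s) n =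
  bin_weight theta m (n v) * convolution s (kill n v).
Proof.
move=> + vs f0 f1 f2; elim: m n => [n _|m ih n nB] /=.
  by rewrite bin_weight0 -convolution_untouched.
have fE k : f k = bin_weight theta 1 k.
  rewrite /bin_weight expr1 coefD coefC coefZ coefX.
  case: k => [|[|k]]; rewrite ?mulr0 ?addr0 ?mulr1 ?add0r//.
  exact: f2.
(* A Bernoulli variable is a binomial one with a single trial, so Vandermonde with 1 + m trials
   gives the induction step. *)
rewrite -add1n bin_weightD mulr_suml.
rewrite -(big_mkord (fits n [set v])
  (fun k => f k * convolution (nseq m ([set v], f) ++ s) (lower n [set v] k))).
rewrite (big_cat_nat (n := (n v).+1))//=.
rewrite [X in _ + X = _]big_nat_cond [X in _ + X = _]big1 ?addr0; last first.
  by move=> i; rewrite fits_set1; lia.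
rewrite -(big_mkord xpredT (fun j => bin_weight theta 1 j *
   bin_weight theta m (n v - j) * convolution s (kill n v))).
rewrite big_nat_cond [RHS]big_nat_cond; apply: eq_big => [k|k /andP[kn]].
  by rewrite fits_set1; lia.
rewrite fits_set1 => {}kn.
rewrite ih; last by rewrite /lower set11; lia.
rewrite fE -mulrA; congr (_ * (_ * _)).
  by rewrite /lower set11 mul1n.
congr (convolution s _); apply: funext => w; rewrite /kill /lower finset.in_set1.
by case: eqP => //= _; rewrite subn0.
Qed.

Definition poisson_convolution (s : seq ({set 'I_d} * R)) n : R :=
  convolution [seq (c.1, poisson_weight c.2) | c <- s] n.

Definition thin_split (theta : R) u v (c : {set 'I_d} * R) :=
  if u \in c.1 then
    [:: (c.1, (1 - theta) * c.2); (v |: c.1, theta * c.2)]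
  else [:: c].

(** The binomial weight is the conditional probability that thinning the [n u] points at [u] leaves
    [n v] points. Marks are drawn set by set, and the marks of the first set combine with those of
    the others by Vandermonde. *)
Lemma poisson_convolution_split theta u v (s : seq ({set 'I_d} * R)) n : u != v ->
  (forall w, (n w < B)%N) ->
  (forall W, W \in map fst s -> v \notin W) ->
  poisson_convolution (flatten [seq thin_split theta u v c | c <- s]) n =
  bin_weight theta (n u) (n v) * poisson_convolution s (kill n v).
Proof.
move=> uv; rewrite /poisson_convolution.
elim: s n => [|[W rate] s ih] n nB vs /=.
  case: (forallP (P := fun w => kill n v w == 0%N)) => [h|h].
    have -> : n u = 0%N by have /eqP := h u; rewrite /kill (negbTE uv).
    rewrite bin_weight0 mulr1; congr (nat_of_bool _)%:R.
    apply/idP/idP => [/forallP//|].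
    move=> /eqP nv; apply/forallP => w; move: (h w); rewrite /kill.
    by case: (w =P v) => [->|//]; rewrite nv.
  rewrite mulr0; case: forallP => // h'; case: h => w.
  by rewrite /kill; case: (w =P v) => // _; exact: h'.
have vW : v \notin W by apply: vs; rewrite mem_head.
have vs' W' : W' \in map fst s -> v \notin W'.
  by move=> W's; apply: vs; rewrite inE W's orbT.
have lowerB n' W' k : (forall w, n' w < B)%N -> (forall w, lower n' W' k w < B)%N.
  by move=> n'B w; rewrite (leq_ltn_trans (leq_subr _ _)).
rewrite mulr_sumr map_cat /thin_split /=; case: ifPn => uW /=; last first.
  apply: eq_big => [k|k _]; first by rewrite fits_kill.
  rewrite ih; [|exact: lowerB|exact: vs'].
  rewrite kill_lower {1 2}/lower (negbTE uW) (negbTE vW) !mul0n !subn0.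
  by rewrite mulrCA.
(* Here [a] counts the unmarked and [b] the marked points of [W]; [u] loses a + b points and [v]
   loses b. *)
pose F a b := if fits n W (a + b) && (b <= n v)%N then
  poisson_weight ((1 - theta) * rate) a * poisson_weight (theta * rate) b *
  bin_weight theta (n u - (a + b)) (n v - b) *
  convolution [seq (c.1, poisson_weight c.2) | c <- s] (lower (kill n v) W (a + b))
  else 0.
transitivity (\sum_(a < B) \sum_(b < B) F a b).
  rewrite big_mkcond /=; apply: eq_bigr => a _.
  case: ifPn => [fa|fa]; last first.
    rewrite big1// => b _; rewrite /F ifN//; apply: contra fa => /andP[+ _].
    by apply: fits_le; rewrite leq_addr.
  rewrite mulr_sumr big_mkcond /=; apply: eq_bigr => b _.
  rewrite /F fitsU1 fits_lower// andbC {1}/lower (negbTE vW) subn0.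
  case: ifP => // _; rewrite ih; [|by apply/lowerB/lowerB|exact: vs'].
  rewrite kill_lowerU kill_lower lowerD.
  have -> : lower (lower n W a) (v |: W) b u = (n u - (a + b))%N.
    by rewrite /lower setU1r// uW !mul1n subnDA.
  have -> : lower (lower n W a) (v |: W) b v = (n v - b)%N.
    by rewrite /lower setU11 (negbTE vW) mul1n subn0.
  by rewrite !mulrA.
(* Since [u] belongs to [W], a fitting total a + b is at most [n u], hence below [B]. *)
rewrite sum_antidiagonal; last first.
  move=> a b ab; rewrite /F; case: ifP => // /andP[/forall_inP /(_ _ uW) + _].
  by have := nB u; lia.
rewrite [RHS]big_mkcond; apply: eq_bigr => k _ /=; rewrite fits_kill//.
have FE (j : 'I_k.+1) : F (k - j)%N j =
    if fits n W k && (j <= n v)%N then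
    poisson_weight rate k * (bin_weight theta k j *
    bin_weight theta (n u - k) (n v - j)) *
    convolution [seq (c.1, poisson_weight c.2) | c <- s] (lower (kill n v) W k)
    else 0.
  have jk : (j <= k)%N by rewrite -ltnS.
  by rewrite /F subnK// poisson_splitting// !mulrA.
under eq_bigr do rewrite FE.
case: ifPn => [fk|nfk]; last by rewrite big1.
have ku : (k <= n u)%N by apply: (forall_inP fk).
rewrite -big_mkcond -mulr_suml -mulr_sumr /=.
rewrite [RHS]mulrCA -[LHS]mulrA; congr (_ * (_ * _)).
(* The [n u] points at [u] are the [k] points of [W] and the remaining [n u - k]. The two
   Vandermonde sums differ only by indices j > k, where the weight vanishes. *)
rewrite -[in RHS](subnKC ku) bin_weightD.
rewrite -(big_mkord (fun j => (j <= n v)%N)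
  (fun j => bin_weight theta k j * bin_weight theta (n u - k) (n v - j))).
rewrite -(big_mkord xpredT
  (fun j => bin_weight theta k j * bin_weight theta (n u - k) (n v - j))).
rewrite (big_nat_widen _ _ (maxn k (n v)).+1) ?ltnS ?leq_maxl//.
rewrite [RHS](big_nat_widen _ _ (maxn k (n v)).+1) ?ltnS ?leq_maxr//.
rewrite [RHS](bigID (fun j => (j < k.+1)%N)) /=.
rewrite [X in _ = _ + X]big1 ?addr0; last first.
  by move=> i /andP[_ ki]; rewrite bin_weight_oversize ?mul0r// ltnNge -ltnS.
by apply: eq_bigl => j; rewrite ltnS.
Qed.

End Convolution.

(** * Subtrees of a growing tree *)

Section Tree.
Import mathcomp.boot.fintype mathcomp.boot.finset.
Context (d : nat) (e : rel 'I_d) (treeE : is_tree e).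
Implicit Types (r u v w x y i j : 'I_d) (W S : {set 'I_d}) (p q : seq 'I_d).

Let symE : symmetric e. Proof. by case: treeE. Qed.

Lemma path_rev i p : path e i p -> path e (last i p) (rev (belast i p)).
Proof. by rewrite rev_path; apply: sub_path => x y; rewrite symE. Qed.

Lemma simple_path_rev i p j :
  simple_path e i p j -> simple_path e j (rev (belast i p)) i.
Proof.
case=> pp up <-; split; first exact: path_rev.
  by rewrite -rev_rcons -lastI rev_uniq.
by case: p {pp up} => //= x p; rewrite rev_cons last_rcons.
Qed.

Lemma simple_path_exists i j : exists p, simple_path e i p j.
Proof.
have [_ _ _ /(_ i j) /connectP[p pp ->] _] := treeE.
by case/shortenP: pp => p' pp' up' _; exists p'.
Qed.

(* A detour would close up, through i, to a simple cycle. *)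
Lemma no_detour i x y p : e i x -> e i y -> path e x p -> last x p = y ->
  i \notin x :: p -> x = y.
Proof.
move=> ix iy pp lp ip; move: lp.
case/shortenP: pp => q pq uq sqp lq.
have iq : i \notin x :: q.
  by apply: contra ip; rewrite !inE => /orP[->//|/sqp ->]; rewrite orbT.
have [_ _ _ _ /(_ (i :: x :: q))] := treeE.
case: q pq uq sqp lq iq => [//|z q] pq uq _ lq iq; case/(_ _)/negPn/negP => //.
rewrite /ucycle cons_uniq iq uq /= rcons_path -symE in pq *.
by move: pq => /= /andP[-> ->]; rewrite ix /= in lq *; rewrite lq symE iy.
Qed.

Lemma path_closed_set1 v : path_closed e [set v].
Proof.
move=> i j p; rewrite !inE => /eqP -> /eqP -> [_ up lp].
case: p up lp => // x p /=; rewrite inE negb_or -andbA => /and4P[vx vp _ _] lp.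
by move: (mem_last x p); rewrite lp inE (negbTE vx) (negbTE vp).
Qed.

(** A simple path from [v] into [W] must start through [u]: its second vertex is joined to [u] by
    the rest of the path followed by a path inside [W], all avoiding [v], so [no_detour] applies. *)
Lemma path_closed_add W u v : path_closed e W -> u \in W -> e u v ->
  path_closed e (v |: W).
Proof.
move=> cW uW uv.
have [vW|vW] := boolP (v \in W); first by rewrite (setUidPr _) ?sub1set.
have from_v j p : j \in W -> simple_path e v p j -> {subset p <= W}.
  move=> jW; case: p => [|x p]; first by [].
  case=> /= /andP[vx pp] /and3P[]; rewrite inE negb_or => /andP[vNx vp] xp up lp.
  suff xu : x = u.
    move=> y; rewrite inE => /orP[/eqP ->|yp]; first by rewrite xu.
    by apply: (cW x j p) => //; rewrite ?xu//; split=> //=; rewrite -?xu ?xp.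
  have [q sq] := simple_path_exists u j; have [pq uq lq] := sq.
  have qW := cW _ _ _ uW jW sq.
  apply: (no_detour (p := p ++ rev (belast u q)) vx); first by rewrite symE.
  - by rewrite cat_path pp lp -lq path_rev.
  - have [_ _] := simple_path_rev sq.
    by rewrite last_cat lp.
  - rewrite -cat_cons mem_cat inE !negb_or vNx vp mem_rev /=.
    apply: contra vW => /mem_belast; rewrite inE => /orP[/eqP ->//|]; exact: qW.
move=> i j p; rewrite !in_setU1 => /orP[/eqP ->|iW] /orP[/eqP ->|jW] sp.
- move=> x /(path_closed_set1 (set11 v) (set11 v) sp).
  by rewrite !inE => ->.
- by move=> x xp; rewrite setU1r// (from_v _ _ jW sp).
- have := from_v _ _ iW (simple_path_rev sp) => sW x xp.
  have : x \in i :: p by rewrite inE xp orbT.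
  rewrite lastI mem_rcons inE => /orP[/eqP ->|xb].
    by have [_ _ ->] := sp; rewrite setU11.
  by rewrite setU1r// sW// mem_rev.
- by move=> x xp; rewrite setU1r// (cW _ _ _ iW jW sp).
Qed.

Section Leaf.
Context (S : {set 'I_d}) (u v : 'I_d).
Hypothesis v_leaf : forall x, x \in S -> e x v -> x = u.

Lemma path_closed_leaf W : path_closed e W -> W \subset v |: S -> v \in W ->
  W != [set v] -> u \in W.
Proof.
move=> cW /subsetP WS vW Wv.
have [w /andP[wW wv]] : exists w, (w \in W) && (w != v).
  apply/existsP; apply: contraR Wv => /existsPn h; rewrite eqEsubset sub1set vW.
  rewrite andbT; apply/subsetP => w wW; rewrite inE.
  by have := h w; rewrite wW negbK.
have [p sp] := simple_path_exists v w; have pW := cW _ _ _ vW wW sp.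
case: p sp pW => [[_ _ /= vw]|x p [/= /andP[vx _] + _] pW].
  by rewrite vw eqxx in wv.
rewrite inE negb_or => /andP[/andP[vNx _] _].
have xW : x \in W by rewrite pW// mem_head.
have := WS x xW; rewrite in_setU1 eq_sym (negbTE vNx) /= => xS.
by rewrite -(v_leaf xS)// symE.
Qed.

(** A leaf is never interior to a simple path: its two neighbours on the path would both be [u]. *)
Lemma path_closed_del W : path_closed e W -> W \subset v |: S ->
  path_closed e (W :\ v).
Proof.
move=> cW /subsetP WS i j p; rewrite !in_setD1 => /andP[iv iW] /andP[jv jW] sp.
have pW := cW _ _ _ iW jW sp.
have nbr x : x \in W -> x != v -> e x v -> x = u.
  by move=> xW xv; apply: v_leaf; have := WS x xW; rewrite in_setU1 (negbTE xv).
suff vp : v \notin p.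
  by move=> x xp; rewrite in_setD1 pW// andbT; apply: contraNneq vp => <-.
apply/negP => vp; case/splitPr: vp sp pW => p1 p2 [pp up lp] pW.
move: pp; rewrite cat_path => /andP[_ /= /andP[xv pp]].
case: p2 pp up lp pW => [_ _|y p2 /andP[vy _]].
  by rewrite last_cat /= => jE; rewrite -jE eqxx in jv.
rewrite -cat_cons cat_uniq => /and3P[_ /hasPn h /andP[+ _]] _ pW.
rewrite inE negb_or => /andP[vNy _].
have xI : last i p1 \in i :: p1 by apply: mem_last.
have xu : last i p1 = u.
  apply: nbr => //.
    move: xI; rewrite inE => /orP[/eqP ->//|xI].
    by rewrite pW// mem_cat xI.
  by apply: contraTneq xI => ->; apply: h; rewrite mem_head.
have yu : y = u.
  apply: nbr; rewrite 1?symE// 1?eq_sym//.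
  by rewrite pW// mem_cat !inE eqxx !orbT.
by have := h y; rewrite /= !inE eqxx orbT yu -xu => /(_ isT); rewrite -in_cons xI.
Qed.

End Leaf.

(** Two neighbours of [v] in [S] are joined by a path inside [S], which avoids [v]. This supplies
    the hypothesis [v_leaf]. *)
Lemma leaf_neighbor S u v x : path_closed e S -> v \notin S -> u \in S ->
  e u v -> x \in S -> e x v -> x = u.
Proof.
move=> cS vS uS uv xS xv.
have [p sp] := simple_path_exists x u; have [pp _ lp] := sp.
apply: (no_detour (i := v) (p := p)) => //; try by rewrite symE.
apply: contra vS; rewrite inE => /orP[/eqP ->//|]; exact: (cS _ _ _ xS uS sp).
Qed.

(** Follow the simple path from [v] to the root up to its first step into [S]; the remaining path
    witnesses the parent relation. *)
Lemma boundary_parent r S v : r \in S -> v \notin S ->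
  exists v' u, [/\ v' \notin S, u \in S, e u v' & is_parent e r v' u].
Proof.
move=> rS vS; have [p sp] := simple_path_exists v r.
elim: p v vS sp => [v vS [_ _ /= vr]|x p ih v vS sp].
  by rewrite vr rS in vS.
have [xS|xS] := boolP (x \in S).
  exists v, x; split=> //; last by exists p.
  by case: sp => /= /andP[]; rewrite symE.
by apply: (ih x xS); case: sp => /= /andP[_ pp] /andP[_ up] lp; split.
Qed.

(** Induction on the number of vertices outside [S]; [boundary_parent] finds the next vertex to
    attach. *)
Lemma tree_growth r (Q : {set 'I_d} -> Prop) : Q [set r] ->
  (forall S u v, r \in S -> path_closed e S -> v \notin S -> u \in S ->
     e u v -> is_parent e r v u -> Q S -> Q (v |: S)) ->
  Q setT.
Proof.
move=> Qr QS.
suff grow k S : #|~: S| = k -> r \in S -> path_closed e S -> Q S -> Q setT.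
  by apply: (grow _ [set r]) => //; [rewrite set11|exact: path_closed_set1].
elim: k S => [|k ih] S cardS rS cS Q0.
  move/eqP: cardS; rewrite cards_eq0 => /eqP/(congr1 (@setC _)).
  by rewrite setCK setC0 => <-.
have [v0] : exists v, v \in ~: S by apply/card_gt0P; rewrite cardS.
rewrite inE => v0S; have [v [u [vS uS uv ru]]] := boundary_parent rS v0S.
apply: (ih (v |: S)).
- move: cardS; rewrite (cardsD1 v) inE vS add1n => -[<-]; congr #|pred_of_set _|.
  by apply/setP => x; rewrite !inE negb_or.
- by rewrite setU1r.
- exact: path_closed_add cS uS uv.
- exact: (QS S u v).
Qed.

Lemma in_Theta v W : (W \in Theta e v) = (v \in W) && `[< path_closed e W >].
Proof. by rewrite inE. Qed.

Lemma in_subtrees W :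
  (W \in subtrees e) = (W != set0) && `[< path_closed e W >].
Proof.
apply/bigcupP/andP => [[v _]|[/set0Pn[v vW] cW]].
  by rewrite in_Theta => /andP[vW ->]; split=> //; apply/set0Pn; exists v.
by exists v; rewrite // in_Theta vW.
Qed.

Definition grow_subtree u v W : seq {set 'I_d} :=
  if u \in W then [:: W; v |: W] else [:: W].

Definition grow_subtrees u v (s : seq {set 'I_d}) : seq {set 'I_d} :=
  [set v] :: flatten [seq grow_subtree u v W | W <- s].

(** The set that produced [X] can be read off: it is [X] itself, or [X :\ v] when [v] is in [X]. *)
Lemma mem_flatten_grow u v (s : seq {set 'I_d}) X : u != v ->
  (forall W, W \in s -> v \notin W) ->
  (X \in flatten [seq grow_subtree u v W | W <- s]) =
  if v \in X then (u \in X) && (X :\ v \in s) else X \in s.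
Proof.
move=> uv; elim: s => [|W s ih] vs /=.
  by rewrite !in_nil andbF if_same.
have vW : v \notin W by apply: vs; rewrite mem_head.
rewrite mem_cat ih; last by move=> Z Zs; apply: vs; rewrite inE Zs orbT.
have XW : v \in X -> (X == W) = false.
  by move=> vX; apply: contraNF vW => /eqP <-.
rewrite /grow_subtree; case: ifPn => uW; rewrite !inE; case: ifPn => vX //.
- rewrite (XW vX) /=; have -> : (X == v |: W) = (X :\ v == W).
    by apply/eqP/eqP => [->|<-]; [rewrite setU1K|rewrite setD1K].
  case: eqP => //= XvW; rewrite andbT.
  by move: uW; rewrite -XvW in_setD1 => /andP[_ ->].
- have -> : (X == v |: W) = false by apply: contraNF vX => /eqP ->; rewrite setU11.
  by rewrite orbF.
- rewrite (XW vX) /=; case: (X :\ v =P W) => //= XvW.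
  have -> : (u \in X) = false; last by [].
  by apply: contraNF uW => uX; rewrite -XvW in_setD1 uv.
Qed.

Lemma uniq_grow u v (s : seq {set 'I_d}) : u != v -> uniq s ->
  (forall W, W \in s -> v \notin W) -> uniq (grow_subtrees u v s).
Proof.
move=> uv us vs; rewrite /grow_subtrees cons_uniq; apply/andP; split.
  by rewrite mem_flatten_grow// set11 inE (negbTE uv).
elim: s us vs => // W s ih /andP[Ws us] vs.
have vs' Z : Z \in s -> v \notin Z by move=> Zs; apply: vs; rewrite inE Zs orbT.
have vW : v \notin W by apply: vs; rewrite mem_head.
rewrite map_cons [flatten _]/= cat_uniq ih// andbT; apply/andP; split.
  rewrite /grow_subtree; case: ifP => // _ /=; rewrite inE !andbT.
  by apply: contraNneq vW => ->; rewrite setU11.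
apply/hasPn => X; rewrite mem_flatten_grow//; apply: contraL.
rewrite /grow_subtree; case: ifP => uW; rewrite !inE.
  case/orP => /eqP ->; first by rewrite (negbTE vW).
  by rewrite setU11 setU1K// (negbTE Ws) andbF.
by move=> /eqP ->; rewrite (negbTE vW).
Qed.

(** A subtree of [v |: S] either avoids [v], or is the singleton of [v], or contains [u] as well and
    remains a subtree once the leaf [v] is removed. *)
Lemma subtrees_grow S u v (s : seq {set 'I_d}) X : path_closed e S ->
  v \notin S -> u \in S -> e u v ->
  (forall W, (W \in s) = (W \in subtrees e) && (W \subset S)) ->
  (X \in grow_subtrees u v s) = (X \in subtrees e) && (X \subset v |: S).
Proof.
move=> cS vS uS uv sE.
have uNv : u != v by apply: contraNneq vS => <-.
have leafS x := @leaf_neighbor S u v x cS vS uS uv.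
have vs W : W \in s -> v \notin W.
  by rewrite sE => /andP[_ /subsetP WS]; apply: contra vS; apply: WS.
rewrite inE mem_flatten_grow// !in_subtrees.
case: ifPn => vX; last first.
  rewrite sE in_subtrees; have -> : (X == [set v]) = false.
    by apply: contraNF vX => /eqP ->; rewrite set11.
  rewrite /=; congr (_ && _); apply/idP/idP => [|/subsetP XS].
    by move=> /subset_trans; apply; apply: subsetU1.
  apply/subsetP => x xX; have := XS x xX; rewrite in_setU1 => /orP[/eqP xv|//].
  by rewrite -xv xX in vX.
have X0 : X != set0 by apply/set0Pn; exists v.
rewrite X0 sE in_subtrees /=; apply/idP/idP.
  case/orP => [/eqP ->|/and3P[uX /andP[_ /asboolP cX] XS]].
    apply/andP; split; last by rewrite sub1set setU11.
    by apply/asboolP; exact: path_closed_set1.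
  rewrite -(setD1K vX) setUS// andbT; apply/asboolP.
  by apply: path_closed_add cX _ uv; rewrite in_setD1 uNv.
case/andP => /asboolP cX XS; have [//|Xv /=] := eqVneq X [set v].
have uX := path_closed_leaf leafS cX XS vX Xv.
rewrite uX /= subDset XS andbT; apply/andP; split.
  by apply/set0Pn; exists u; rewrite in_setD1 uNv.
by apply/asboolP; exact: path_closed_del leafS _ cX XS.
Qed.

End Tree.

(** * Rates of a growing tree *)

Section RestrictedGamma.
Import mathcomp.boot.fintype mathcomp.boot.finset.
Context (R : realType) (d : nat) (e : rel 'I_d).
Context (lambda : 'I_d -> R) (alpha : 'I_d -> 'I_d -> R).
Implicit Types (S W : {set 'I_d}) (u v : 'I_d).

(* The edges leaving S are dropped: this is gamma for the tree spanned by S. *)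
Definition gamma_in S W : R :=
  (\prod_(w in W) lambda w)
  * (\prod_(ij in inner_edges e W)
       (alpha ij.1 ij.2 / Num.sqrt (lambda ij.1 * lambda ij.2)))
  * (\prod_(ij in boundary_edges e W | ij.2 \in S)
       (1 - alpha ij.1 ij.2 * Num.sqrt (lambda ij.2 / lambda ij.1))).

Lemma gamma_inT W : gamma_in setT W = gamma e lambda alpha W.
Proof. by congr (_ * _); apply: eq_bigl => ij; rewrite in_setT andbT. Qed.

Hypotheses (symE : symmetric e) (irrE : irreflexive e).
Hypothesis lambda_gt0 : forall v, 0 < lambda v.
Hypothesis symA : forall u v, e u v -> alpha u v = alpha v u.

Lemma inner_edges1 v : inner_edges e [set v] = set0.
Proof.
apply/setP => -[i j]; rewrite !inE /=; apply/negP => /and4P[_ /eqP -> /eqP ->].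
by rewrite ltnn.
Qed.

Lemma gamma_in1 v : gamma_in [set v] [set v] = lambda v.
Proof.
rewrite /gamma_in big_set1 inner_edges1 big_set0 mulr1 big1 ?mulr1// => -[i j].
by rewrite !inE /= => /andP[/and3P[_ _ /negP]].
Qed.

(** Relates the thinning parameter to the inner-edge factor of [gamma]: multiplied by [alpha u v],
    the right side is the vertex factor of [v] times the factor of the edge. *)
Lemma sqrt_ratio u v :
  Num.sqrt (lambda v / lambda u) = lambda v / Num.sqrt (lambda u * lambda v).
Proof.
have [lu lv] := (lambda_gt0 u, lambda_gt0 v).
rewrite [in RHS]sqrtrM ?ltW// sqrtrM ?ltW// sqrtrV ?ltW//.
rewrite -[in X in _ = X / _](sqr_sqrtr (ltW lv)).
have su : Num.sqrt (lambda u) != 0 by rewrite gt_eqF// sqrtr_gt0.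
have sv : Num.sqrt (lambda v) != 0 by rewrite gt_eqF// sqrtr_gt0.
by field; rewrite su sv.
Qed.

Section Leaf.
Context (S : {set 'I_d}) (u v : 'I_d).
Hypotheses (vS : v \notin S) (uS : u \in S) (uv : e u v).
Hypothesis v_leaf : forall x, x \in S -> e x v -> x = u.

(** The only boundary edge inside [v |: S] is (v, u), so the rate is that of the innovation at
    [v]. *)
Lemma gamma_in_leaf : gamma_in (v |: S) [set v] =
  lambda v * (1 - alpha u v * Num.sqrt (lambda u / lambda v)).
Proof.
rewrite /gamma_in big_set1 inner_edges1 big_set0 mulr1; congr (_ * _).
rewrite (symA uv) (big_pred1 (v, u))// => -[i j]; rewrite !inE xpair_eqE /=.
have [->/=|_] := eqVneq i v; last by rewrite andbF.
apply/idP/eqP => [/andP[/andP[vj jv]]|->].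
  by rewrite (negbTE jv) => jS; apply: v_leaf; rewrite // symE.
rewrite symE uv uS orbT andbT /=.
by apply: contraNneq vS => <-.
Qed.

Lemma gamma_in_far W : W \subset S -> u \notin W ->
  gamma_in (v |: S) W = gamma_in S W.
Proof.
move=> /subsetP WS uW; congr (_ * _); apply: eq_bigl => -[i j].
rewrite !inE /=; have [->|//] := eqVneq j v; rewrite (negbTE vS) andbF.
apply/negP => /andP[/and3P[iv iW _] _].
by move: uW; rewrite -(v_leaf (WS _ iW) iv) iW.
Qed.

(** Attaching [v] adds exactly one boundary edge to [W], namely (u, v), whose factor is one minus
    the thinning parameter. *)
Lemma gamma_in_stay W : W \subset S -> u \in W ->
  gamma_in (v |: S) W =
  (1 - alpha u v * Num.sqrt (lambda v / lambda u)) * gamma_in S W.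
Proof.
move=> /subsetP WS uW; have vW : v \notin W by apply: contra vS; apply: WS.
rewrite /gamma_in mulrCA; congr (_ * _).
rewrite (bigD1 (u, v)) /=; last by rewrite !inE /= uv uW vW eqxx.
congr (_ * _); apply: eq_bigl => -[i j]; rewrite !inE xpair_eqE /=.
have [->|_] := eqVneq j v; last by rewrite andbF andbT.
rewrite (negbTE vS) andbT andbF; apply/negP => /andP[/andP[/and3P[iv iW _] _]].
by rewrite (v_leaf (WS _ iW) iv) eqxx.
Qed.

(** The new factors are the vertex [v] and the inner edge between [u] and [v]; no boundary edge
    appears, since [u] is the only neighbour of [v] in [S]. *)
Lemma gamma_in_spread W : W \subset S -> u \in W ->
  gamma_in (v |: S) (v |: W) =
  alpha u v * Num.sqrt (lambda v / lambda u) * gamma_in S W.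
Proof.
move=> /subsetP WS uW; have vW : v \notin W by apply: contra vS; apply: WS.
have uNv : u != v by apply: contraNneq vS => <-.
rewrite /gamma_in big_setU1//= !mulrA; congr (_ * _); last first.
  apply: eq_bigl => -[i j]; rewrite !inE /= negb_or.
  have [->|jv] := eqVneq j v; first by rewrite (negbTE vS) !andbF.
  have [->|//] /= := eqVneq i v; rewrite (negbTE vW) /= andbF.
  apply/negP => /andP[/andP[vj jW] jS].
  by move: jW; rewrite (v_leaf jS) ?uW// symE.
(* [inner_edges] keeps only the increasing orientation of an edge. *)
pose uv' := if (u < v)%N then (u, v) else (v, u).
have -> : inner_edges e (v |: W) = uv' |: inner_edges e W.
  apply/setP => -[i j]; rewrite !inE /uv' (fun_if (fun x => (i, j) == x)).
  rewrite !xpair_eqE /=.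
  have [->|iv] /= := eqVneq i v.
    rewrite [v == u]eq_sym (negbTE uNv) (negbTE vW) !andbF orbF /=.
    have [->|jv] /= := eqVneq j v; first by rewrite irrE eq_sym (negbTE uNv) if_same.
    apply/idP/idP => [/and3P[vj jW vltj]|].
      have ju : j = u by apply: v_leaf; rewrite ?WS// symE.
      by rewrite -ju ltnNge (ltnW vltj) /= eqxx.
    case: ltnP => // vu /eqP ->; rewrite symE uv uW /=.
    by rewrite ltn_neqAle vu andbT eq_sym.
  have [->|jv] /= := eqVneq j v; last first.
    by rewrite andbF if_same.
  rewrite (negbTE vW) !andbF orbF andbT /=.
  apply/idP/idP => [/and3P[iv' iW iltv]|].
    by rewrite -(v_leaf (WS _ iW) iv') iltv eqxx.
  by case: ltnP => // uv'' /eqP ->; rewrite uv uW.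
rewrite big_setU1 /=; last first.
  by rewrite !inE /uv'; case: ifP => /=; rewrite (negbTE vW) !andbF.
rewrite !mulrA; congr (_ * _).
rewrite -[X in X = _]mulrA.
have -> : alpha uv'.1 uv'.2 / Num.sqrt (lambda uv'.1 * lambda uv'.2) =
    alpha u v / Num.sqrt (lambda u * lambda v).
  by rewrite /uv'; case: ifP => //= _; rewrite -(symA uv) [lambda v * _]mulrC.
by rewrite sqrt_ratio; ring.
Qed.

Lemma gamma_in_grow (s : seq {set 'I_d}) :
  (forall W, W \in s -> W \subset S) ->
  [seq (W, gamma_in (v |: S) W) | W <- grow_subtrees u v s] =
  ([set v], lambda v * (1 - alpha u v * Num.sqrt (lambda u / lambda v))) ::
  flatten [seq thin_split (alpha u v * Num.sqrt (lambda v / lambda u)) u v c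
          | c <- [seq (W, gamma_in S W) | W <- s]].
Proof.
move=> sS; rewrite /grow_subtrees /= gamma_in_leaf; congr (_ :: _).
elim: s sS => //= W s ih sS; rewrite map_cat ih; last first.
  by move=> Z Zs; apply: sS; rewrite inE Zs orbT.
have WS : W \subset S by apply: sS; rewrite mem_head.
congr (_ ++ _); rewrite /grow_subtree /thin_split /=; case: ifPn => uW /=.
  by rewrite gamma_in_stay// gamma_in_spread.
by rewrite gamma_in_far.
Qed.

End Leaf.
End RestrictedGamma.

(** * Sums of independent counts *)

Section IndependentSum.
Local Open Scope classical_set_scope.
Context (R : realType) (disp : measure_display) (T : measurableType disp).
Context (P : probability T R) (I : choiceType) (D : set I).
Context (X : I -> T -> nat) (d B : nat) (W : I -> {set 'I_d}).
Implicit Types (s : seq I) (n : 'I_d -> nat).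

Definition sum_event s n : set T :=
  [set t | forall v, (\sum_(i <- s | v \in W i) X i t)%N = n v].

Definition count_pmf (i : I) (k : nat) : R := fine (P (X i @^-1` [set k])).

Hypothesis mX : forall i A, D i -> measurable (X i @^-1` A).
Hypothesis indepX : mutually_independent P D X.

(** Splits on the value of [X i], which is below [B] because [W i] contains some [w] and [n w] is
    below [B]. *)
Lemma sum_event_cons s n i : W i != finset.set0 -> (forall v, (n v < B)%N) ->
  sum_event (i :: s) n =
  \big[setU/set0]_(k < B | fits n (W i) k)
    (X i @^-1` [set nat_of_ord k] `&` sum_event s (lower n (W i) k)).
Proof.
move=> Wi nB; have [w wW] := finset.set0Pn _ Wi.
rewrite -(bigcup_pred [pred k : 'I_B | fits n (W i) k]).
have headE t v : (\sum_(j <- i :: s | v \in W j) X j t =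
    (v \in W i) * X i t + \sum_(j <- s | v \in W j) X j t)%N.
  by rewrite big_cons; case: ifP; rewrite ?mul1n.
apply/seteqP; split=> t.
  move=> h; have XB : (X i t < B)%N.
    by apply: leq_ltn_trans (nB w); rewrite -h headE wW mul1n leq_addr.
  exists (Ordinal XB) => /=.
    by apply/forall_inP => v vW; rewrite -h headE vW mul1n leq_addr.
  by split=> // v; rewrite /lower -h headE addKn.
move=> [k /= /forall_inP fk [Xk h]] v; rewrite headE h /lower Xk subnKC//.
by case vW : (v \in W i); rewrite ?mul1n//; apply: fk.
Qed.

Lemma measurable_sum_event s n : (forall i, i \in s -> D i) ->
  (forall i, i \in s -> W i != finset.set0) -> (forall v, (n v < B)%N) ->
  measurable (sum_event s n).
Proof.
elim: s n => [|i s ih] n sD sW nB.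
  have [h|h] := pselect (forall v, 0%N = n v).
    rewrite (_ : sum_event _ _ = setT)//; apply/seteqP; split=> // t _ v.
    by rewrite big_nil.
  rewrite (_ : sum_event _ _ = set0)//; apply/seteqP; split=> // t ht.
  by apply: h => v; rewrite -ht big_nil.
rewrite sum_event_cons ?sW ?mem_head//; apply: bigsetU_measurable => k _.
apply: measurableI; first by apply/mX/sD; rewrite mem_head.
apply: ih => [j js|j js|v]; first by apply: sD; rewrite inE js orbT.
  by apply: sW; rewrite inE js orbT.
by rewrite (leq_ltn_trans (leq_subr _ _)).
Qed.

(* The extra events indexed by J make the induction on s go through. *)
Lemma probability_sum_event_cond s n (J : {fset I}) (A : I -> set nat) :
  uniq s -> (forall i, i \in s -> D i) ->
  (forall i, i \in s -> W i != finset.set0) -> (forall v, (n v < B)%N) ->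
  [set` J] `<=` D -> (forall i, i \in s -> i \notin J) ->
  P (\bigcap_(i in [set` J]) (X i @^-1` A i) `&` sum_event s n) =
  ((\prod_(i <- J) fine (P (X i @^-1` A i))) *
   convolution B [seq (W i, count_pmf i) | i <- s] n)%:E.
Proof.
elim: s n J A => [|i s ih] n J A us sD sW nB JD sJ.
  have PJ : P (\bigcap_(i in [set` J]) (X i @^-1` A i)) =
      (\prod_(i <- J) fine (P (X i @^-1` A i)))%:E.
    rewrite indepX// -prodEFin big_seq [RHS]big_seq; apply: eq_bigr => i iJ.
    by rewrite fineK// fin_num_measure//; apply/mX/JD.
  rewrite /=; case: forallP => h.
    rewrite (_ : sum_event _ _ = setT) ?setIT ?PJ ?mulr1//.
    by apply/seteqP; split=> // t _ v; rewrite big_nil; apply/esym/eqP.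
  rewrite (_ : sum_event _ _ = set0) ?setI0 ?measure0 ?mulr0//.
  apply/seteqP; split=> // t ht; apply: h => v.
  by rewrite -ht big_nil.
have sD' j : j \in s -> D j by move=> js; apply: sD; rewrite inE js orbT.
have sW' j : j \in s -> W j != finset.set0.
  by move=> js; apply: sW; rewrite inE js orbT.
have Di : D i by apply: sD; rewrite mem_head.
have iJ : i \notin J by apply: sJ; rewrite mem_head.
move: us => /= /andP[iNs us].
have nB' k v : (lower n (W i) k v < B)%N.
  by rewrite (leq_ltn_trans (leq_subr _ _)).
rewrite sum_event_cons ?sW ?mem_head// big_distrr/=.
rewrite measure_bigsetU_ord_cond; first last.
- apply/trivIsetP => k l _ _ kl; apply/seteqP; split=> // t /=.
  move=> [[_ [Xk _]] [_ [Xl _]]]; move/eqP: kl; apply.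
  by apply/val_inj; exact: etrans (esym Xk) Xl.
- move=> k _; apply: measurableI; last first.
    by apply: measurableI; [exact: mX|exact: measurable_sum_event].
  by apply: fin_bigcap_measurable => // j jJ; apply/mX/JD.
rewrite mulr_sumr -sumEFin; apply: eq_bigr => k fk.
(* The condition X_i = k moves the index [i] from the list to the extra events. *)
pose A' j := if j == i then [set nat_of_ord k] else A j.
rewrite setIA.
have -> : \bigcap_(j in [set` J]) (X j @^-1` A j) `&` (X i @^-1` [set nat_of_ord k]) =
    \bigcap_(j in [set` (i |` J)%fset]) (X j @^-1` A' j).
  rewrite bigcap_fsetU1 setIC /A' eqxx; congr (_ `&` _).
  by apply: eq_bigcapr => j /= jJ; rewrite ifN//; apply: contraNneq iJ => <-.
have JD' : [set` (i |` J)%fset] `<=` D.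
  by move=> j /=; rewrite !inE => /orP[/eqP ->//|]; exact: JD.
apply: etrans (ih (lower n (W i) k) _ A' us sD' sW' (nB' k) JD' _) _.
  move=> j js; rewrite !inE negb_or sJ ?inE ?js ?orbT// andbT.
  by apply: contraNneq iNs => <-.
rewrite big_fsetU1//= /A' eqxx -/(count_pmf i k) -!mulrA mulrCA.
congr (_ * _)%:E.
rewrite big_seq [RHS]big_seq; apply: eq_bigr => j jJ.
by rewrite ifN//; apply: contraNneq iJ => <-.
Qed.

Lemma probability_sum_event s n : uniq s -> (forall i, i \in s -> D i) ->
  (forall i, i \in s -> W i != finset.set0) -> (forall v, (n v < B)%N) ->
  P (sum_event s n) = (convolution B [seq (W i, count_pmf i) | i <- s] n)%:E.
Proof.
move=> us sD sW nB.
have := @probability_sum_event_cond s n fset0 (fun=> setT) us sD sW nB.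
rewrite big_seq_fset0 mul1r => <- //.
congr (P _); rewrite -[LHS]setTI; congr (_ `&` _).
by apply/seteqP; split=> // t _ i /=; rewrite inE.
Qed.

End IndependentSum.

(** * Laws and atoms *)

Section Law.
Local Open Scope classical_set_scope.
Context (R : realType) (d : nat).
Context (disp : measure_display) (T : measurableType disp) (P : probability T R).

(** [{ffun 'I_d -> nat}] is countable, so the event is a disjoint union of atoms indexed by pickling
    codes; integers that code nothing contribute the empty set. *)
Lemma law_atoms (N : 'I_d -> T -> nat) (A : set ('I_d -> nat)) :
  (forall n, measurable [set t | (fun v => N v t) = n]) ->
  P [set t | A (fun v => N v t)] =
  (\sum_(i <oo) if pickle_inv i is Some f then
     if `[< A (fun v => (f : {ffun 'I_d -> nat}) v) >] then
       P [set t | (fun v => N v t) = (fun v => f v)] else 0 else 0)%E.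
Proof.
move=> mN.
pose F i : set T := if pickle_inv i is Some f then
   if `[< A (fun v => (f : {ffun 'I_d -> nat}) v) >] then
     [set t | (fun v => N v t) = (fun v => f v)] else set0 else set0.
have FE : [set t | A (fun v => N v t)] = \bigcup_i F i.
  apply/seteqP; split=> [t At|t [i _]].
    pose f : {ffun 'I_d -> nat} := finfun (fun v => N v t).
    have NE : (fun v => N v t) = (fun v => f v) by apply: funext => v; rewrite ffunE.
    exists (choice.pickle f) => //; rewrite /F pickleK_inv ifT//.
    by apply/asboolP; rewrite -NE.
  by rewrite /F; case: pickle_inv => // f; case: asboolP => //= Af ->.
have mF i : measurable (F i).
  by rewrite /F; case: pickle_inv => // f; case: ifP.
rewrite FE measure_bigcup//.
  rewrite eseries_mkcond; apply: eq_eseriesr => i _; rewrite in_setT /F.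
  case: pickle_inv => [f|]; last by rewrite measure0.
  by case: ifP => // _; rewrite measure0.
apply/trivIsetP => i j _ _ /eqP ij; apply/seteqP; split=> // t [].
rewrite /F; case Ei : (pickle_inv i) => [f|//].
case Ej : (pickle_inv j) => [g|//]; do 2!case: ifP => // _.
move=> /= -> /(congr1 (fun h => h _)) fg; apply: ij.
have fE : f = g by apply/ffunP => v; apply: fg.
have := @pickle_invK {ffun 'I_d -> nat} i.
by have := @pickle_invK {ffun 'I_d -> nat} j; rewrite Ei Ej /= fE => <- <-.
Qed.

End Law.

Lemma same_law_atoms (R : realType) (d : nat)
    (disp : measure_display) (T : measurableType disp) (P : probability T R)
    (N : 'I_d -> T -> nat)
    (disp' : measure_display) (T' : measurableType disp')
    (P' : probability T' R) (N' : 'I_d -> T' -> nat) :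
  (forall n, measurable [set t | (fun v => N v t) = n]%classic) ->
  (forall n, measurable [set t | (fun v => N' v t) = n]%classic) ->
  (forall n, P [set t | (fun v => N v t) = n]%classic =
             P' [set t | (fun v => N' v t) = n]%classic) ->
  same_law P N P' N'.
Proof.
move=> mN mN' NN' A; rewrite !law_atoms//; apply: eq_eseriesr => i _.
by case: pickle_inv => // f; rewrite NN'.
Qed.

(** * Existence of independent Poisson families *)

Section Existence.
Local Open Scope classical_set_scope.
Context (R : realType) (K : choiceType) (rate : K -> R).

(** The new variable is the second coordinate of the product with [nat] under its Poisson law; the
    old ones are read on the first coordinate. *)
Lemma mutually_independent_poisson_extend (s : seq K) (k : K) (disp : measure_display)
    (T : measurableType disp) (P : probability T R) (Y : K -> {RV P >-> nat}) :
  0 <= rate k -> k \notin s ->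
  mutually_independent P [set` s] Y ->
  (forall i, i \in s -> poisson_distributed (Y i) (rate i)) ->
  exists (P' : probability (T * nat)%type R) (Y' : K -> {RV P' >-> nat}),
    mutually_independent P' [set` k :: s] Y' /\
    forall i, i \in k :: s -> poisson_distributed (Y' i) (rate i).
Proof.
move=> rk ks indY distY.
pose Q : probability nat R := poisson_prob (rate k) 0%N.
pose P' : probability (T * nat)%type R := (P \x Q)%E.
pose f i : T * nat -> nat := if i == k then snd else Y i \o fst.
have mf i : measurable_fun setT (f i).
  rewrite /f; case: ifP => _; first exact: measurable_snd.
  by apply: measurableT_comp => //; exact: measurable_fst.
pose Y' i : {RV P' >-> nat} :=
  HB.pack (f i) (isMeasurableFun.Build _ _ _ _ (f i) (mf i)).
have fk A : f k @^-1` A = setT `*` A.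
  by apply/seteqP; split=> -[x y]; rewrite /f /= eqxx //; case.
have fY i A : i != k -> f i @^-1` A = (Y i @^-1` A) `*` setT.
  move=> ik; apply/seteqP; split=> -[x y]; rewrite /f /= (negbTE ik) //.
  by case.
have P'X A C : measurable A -> P' (A `*` C) = (P A * Q C)%E.
  by move=> mA; exact: product_measure1E.
have P'k A : P' (f k @^-1` A) = Q A.
  by rewrite fk P'X// probability_setT mul1e.
have mY i A : measurable (Y i @^-1` A).
  by rewrite -[X in measurable X]setTI; exact: measurable_funP.
have P'Y i A : i != k -> P' (f i @^-1` A) = P (Y i @^-1` A).
  move=> ik; rewrite fY// P'X//.
  by rewrite probability_setT mule1.
exists P', Y'; split.
  move=> J A JD; rewrite /=.
  have bigcapY (J' : {fset K}) : (forall i, i \in J' -> i \in s) ->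
      \bigcap_(i in [set` J']) (f i @^-1` A i) =
      (\bigcap_(i in [set` J']) (Y i @^-1` A i)) `*` setT.
    move=> J's; have J'k i : i \in J' -> i != k.
      by move=> iJ; apply: contraNneq ks => <-; apply: J's.
    apply/seteqP; split=> -[x y] /=.
      by move=> h; split=> // i iJ; have := h i iJ; rewrite fY ?J'k// => -[].
    by move=> [h _] i iJ; rewrite fY ?J'k//; split=> //; apply: h.
  have prodY (J' : {fset K}) : (forall i, i \in J' -> i \in s) ->
      P (\bigcap_(i in [set` J']) (Y i @^-1` A i)) =
      (\prod_(i <- J') P' (f i @^-1` A i))%E.
    move=> J's; rewrite indY; last by move=> i; exact: J's.
    rewrite big_seq [RHS]big_seq; apply: eq_bigr => i iJ; rewrite P'Y//.
    by apply: contraNneq ks => <-; apply: J's.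
  have mcap (J' : {fset K}) : measurable (\bigcap_(i in [set` J']) (Y i @^-1` A i)).
    by apply: fin_bigcap_measurable => // i _; exact: mY.
  have [kJ|kJ] := boolP (k \in J); last first.
    have Js i : i \in J -> i \in s.
      move=> iJ; have := JD i iJ; rewrite /= inE => /orP[/eqP ik|//].
      by rewrite ik (negbTE kJ) in iJ.
    rewrite bigcapY// -prodY// P'X//.
    by rewrite probability_setT mule1.
  have Js i : i \in (J `\ k)%fset -> i \in s.
    rewrite !inE => /andP[ik iJ]; have := JD i iJ.
    by rewrite /= inE (negbTE ik).
  rewrite (bigcap_fsetD1 (x := k) _ kJ) (big_fsetD1 k kJ)/= bigcapY// -prodY// P'k fk.
  rewrite (_ : _ `&` _ = (\bigcap_(i in [set` (J `\ k)%fset]) (Y i @^-1` A i)) `*` A k).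
    by rewrite P'X// muleC.
  by apply/seteqP; split=> -[x y] /= => [[[_ Ay] [h _]]|[h Ay]].
move=> i; rewrite inE => /orP[/eqP ->|iS].
  by split=> // A; exact: P'k.
have ik : i != k by apply: contraNneq ks => <-.
have [r0 h] := distY i iS; split=> // A.
by rewrite -h; apply: P'Y.
Qed.

Lemma independent_poisson_exists (s : seq K) : uniq s ->
  (forall i, i \in s -> 0 <= rate i) ->
  exists (disp : measure_display) (T : measurableType disp)
    (P : probability T R) (Y : K -> {RV P >-> nat}),
    mutually_independent P [set` s] Y /\
    forall i, i \in s -> poisson_distributed (Y i) (rate i).
Proof.
elim: s => [_ _|k s ih /= /andP[ks us] r0].
  pose P : probability nat R := poisson_prob 0 0%N.
  exists _, nat, P, (fun=> (cst 0%N : {mfun _ >-> nat})); split=> // J A J0.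
  have -> : J = fset0.
    by apply/fsetP => i; rewrite inE; apply/negP => /J0.
  by rewrite big_seq_fset0 -[RHS](probability_setT P); congr (P _);
     apply/seteqP; split=> // t _ i.
have [|disp [T [P [Y [indY distY]]]]] := ih us.
  by move=> i iS; apply: r0; rewrite inE iS orbT.
have [|P' [Y' h]] := mutually_independent_poisson_extend _ ks indY distY.
  by apply: r0; rewrite mem_head.
by exists _, (T * nat)%type, P', Y'.
Qed.

End Existence.

(** * The stochastic representation *)

Lemma poisson_prob_set1 (R : realType) (rate : R) k : 0 <= rate ->
  poisson_prob rate 0%N [set k]%classic = (poisson_weight rate k)%:E.
Proof.
rewrite le_eqVlt /poisson_prob => /orP[/eqP <-|rate0].
  rewrite ltxx diracE /poisson_weight oppr0 expR0 mulr1 expr0n; congr _%:E.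
  have -> : (0%N \in [set k]%classic) = (k == 0%N).
    by apply/idP/eqP; [rewrite inE|move=> ->; rewrite inE].
  by case: eqP => [->|]; rewrite ?mul0r// fact0 invr1 mulr1.
rewrite rate0 esum_set1 /poisson_pmf rate0// lee_fin.
by rewrite !mulr_ge0 ?exprn_ge0 ?expR_ge0 ?ltW.
Qed.

Lemma restrict_bound (d : nat) (n : 'I_d -> nat) v : (n v < (\sum_w n w).+1)%N.
Proof. by rewrite ltnS (bigD1 v)//= leq_addr. Qed.

Section Construction.
Context (R : realType) (d : nat) (e : rel 'I_d).
Context (lambda : 'I_d -> R) (alpha : 'I_d -> 'I_d -> R).
Hypotheses (treeE : is_tree e) (admE : admissible e lambda alpha).

Definition vertex (i : 'I_d + 'I_d * nat) : 'I_d :=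
  match i with inl v => v | inr (v, _) => v end.

(** [sum_event] constrains every vertex, and at vertices outside [S] the sums are empty, hence the
    value 0. *)
Definition restrict_count (n : 'I_d -> nat) (S : {set 'I_d}) : 'I_d -> nat :=
  fun w => if w \in S then n w else 0%N.

Lemma restrictT n : restrict_count n [set: 'I_d]%SET = n.
Proof. by apply: funext => v; rewrite /restrict_count finset.in_setT. Qed.

Context (disp : measure_display) (T : measurableType disp).
Context (P : probability T R) (r : 'I_d).
Context (L : 'I_d -> {RV P >-> nat}) (B : 'I_d -> nat -> {RV P >-> bool}).
Context (N : 'I_d -> T -> nat).
Hypothesis constr : MPMRF_construction e lambda alpha r L B N.

Let X (k : 'I_d + 'I_d * nat) (t : T) : nat :=
  match k with inl v => L v t | inr (v, j) => B v j t : nat end.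

Let D : set ('I_d + 'I_d * nat) :=
  fun k => match k with inl _ => True | inr (v, _) => v != r end.

Let W (i : 'I_d + 'I_d * nat) : {set 'I_d} := [set vertex i]%SET.

Lemma measurable_innovation i A : measurable (X i @^-1` A)%classic.
Proof.
case: i => [v|[v j]].
  by rewrite -[Y in measurable Y]setTI; exact: measurable_funP.
rewrite (_ : (_ @^-1` A)%classic = (B v j @^-1` [set b | A (nat_of_bool b)])%classic)//.
by rewrite -[Y in measurable Y]setTI; exact: measurable_funP.
Qed.

Lemma pmf_poisson v rate : poisson_distributed (L v) rate ->
  count_pmf P X (inl v) = poisson_weight rate.
Proof.
move=> [rate0 h]; apply: funext => k.
by rewrite /count_pmf; have := h [set k]%classic; rewrite poisson_prob_set1// => /= hk;
  rewrite [X in fine X]hk.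
Qed.

Definition bernoulli_weight (theta : R) (k : nat) : R :=
  if k is k'.+1 then (if k' is 0%N then theta else 0) else 1 - theta.

Lemma pmf_bernoulli v j theta : bernoulli_distributed (B v j) theta ->
  count_pmf P X (inr (v, j)) = bernoulli_weight theta.
Proof.
move=> [theta01 h]; apply: funext => k.
have := h [set b | nat_of_bool b = k]%classic.
rewrite bernoulli_probE// !diracE => hk.
rewrite /count_pmf [X in fine X]hk.
have in_b (b : bool) : (b \in [set b | nat_of_bool b = k]%classic) = (nat_of_bool b == k).
  by apply/idP/eqP; rewrite inE.
rewrite !in_b; case: k {h hk in_b} => [|[|k]] /=.
- by rewrite mulr0 mulr1 add0r.
- by rewrite mulr0 mulr1 addr0.
- by rewrite !mulr0 addr0.
Qed.

(** Proved along the growth of the tree with the invariant [Q]: the list [s] holds the finitely many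
    innovations that decide N = n on [S], the list [ss] holds the subtrees of [S], and their
    convolutions agree. *)
Lemma pmf_construction (n : 'I_d -> nat) :
  exists ss : seq {set 'I_d},
  [/\ uniq ss, (forall Z, (Z \in ss) = (Z \in subtrees e)) &
      P [set t | (fun v => N v t) = n]%classic =
      (poisson_convolution (\sum_w n w).+1
         [seq (Z, gamma e lambda alpha Z) | Z <- ss] n)%:E].
Proof.
have [_ symE irrE _ _] := treeE; have [lambda_gt0 symA _] := admE.
have [indX distr Nr Nv] := constr.
set b := (\sum_w n w).+1.
pose Q (S : {set 'I_d}) := exists s ss,
  [/\ uniq s, (forall i, i \in s -> D i /\ vertex i \in S),
      (forall t, (forall w, w \in S -> N w t = n w) <->
                 sum_event X W s (restrict_count n S) t) &
   [/\ uniq ss,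
      (forall Z, (Z \in ss) = (Z \in subtrees e) && (Z \subset S)) &
      convolution b [seq (W i, count_pmf P X i) | i <- s] (restrict_count n S) =
      poisson_convolution b [seq (Z, gamma_in e lambda alpha S Z) | Z <- ss]
        (restrict_count n S)]].
suff [s [ss [us sD sN [uss ssE convE]]]] : Q [set: 'I_d]%SET.
  exists ss; split=> // [Z|]; first by rewrite ssE finset.subsetT andbT.
  rewrite restrictT in sN convE.
  have -> : [set t | (fun v => N v t) = n]%classic = sum_event X W s n.
    apply/seteqP; split=> t.
      by move=> /= Nn; apply/sN => w _; rewrite -Nn.
    by move=> /sN h; apply: funext => w; apply: h.
  rewrite (@probability_sum_event _ _ _ P _ D _ _ b).
  - rewrite convE; congr (poisson_convolution _ _ _)%:E.
    by apply: eq_map => Z; rewrite gamma_inT.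
  - by move=> i A _; exact: measurable_innovation.
  - exact: indX.
  - by [].
  - by move=> i /sD[].
  - by move=> i _; apply/finset.set0Pn; exists (vertex i); rewrite finset.set11.
  - by move=> v; exact: restrict_bound.
apply: (tree_growth treeE (r := r)).
  exists [:: inl r], [:: [set r]%SET]; split=> //.
  - by move=> i; rewrite inE => /eqP ->; rewrite finset.set11.
  - move=> t; rewrite /sum_event /= /restrict_count; split=> [h w|h w].
      rewrite big_mkcond big_seq1 /= !finset.inE; case: eqP => // ->.
      by rewrite -h ?finset.set11// Nr.
    rewrite finset.inE => /eqP ->; have := h r.
    by rewrite big_mkcond big_seq1 /= finset.set11 Nr.
  split=> // [Z|].
    rewrite inE in_subtrees finset.subset1.
    have [->|_] := eqVneq Z [set r]%SET; last by case: eqP; rewrite ?andbF.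
    rewrite andbT; apply/esym/andP; split; last exact/asboolP/path_closed_set1.
    by apply/finset.set0Pn; exists r; rewrite finset.set11.
  rewrite /poisson_convolution /=; apply: eq_bigr => k _.
  by rewrite gamma_in1// (pmf_poisson distr).
move=> S u v rS cS vS uS uv par [s [ss [us sD sN [uss ssE convE]]]].
have [distL distB NvE] := Nv v u par.
have uNv : u != v by apply: contraNneq vS => <-.
have vr : v != r by apply: contraNneq vS => ->.
have leafS x : x \in S -> e x v -> x = u by apply: leaf_neighbor.
set theta := alpha u v * Num.sqrt (lambda v / lambda u) in distB.
(* Given N_u = [n u], only the first [n u] Bernoulli variables at [v] matter. *)
pose sB : seq ('I_d + 'I_d * nat) := [seq inr (v, j) | j <- index_iota 0 (n u)].
exists (inl v :: sB ++ s), (grow_subtrees u v ss); split.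
- have vs i : vertex i = v -> i \notin s.
    by move=> iv; apply: contra vS => /sD[_]; rewrite iv.
  rewrite cons_uniq cat_uniq us andbT mem_cat negb_or vs// andbT; apply/and3P; split.
  + by apply/mapP => -[].
  + by rewrite /sB map_inj_uniq ?iota_uniq// => j k [].
  + apply/hasPn => i si; apply/mapP => -[j _ ij]; move: si.
    by rewrite ij; apply/negP/vs.
- move=> i; rewrite inE mem_cat => /or3P[/eqP ->|/mapP[j _ ->]|/sD[Di iS]].
  + by rewrite finset.setU11.
  + by split=> //; rewrite finset.setU11.
  + by split=> //; rewrite finset.setU1r.
- move=> t.
  have s0 : (\sum_(i <- s | v \in W i) X i t = 0)%N.
    rewrite big_seq_cond big1// => i /andP[/sD[_ iS]]; rewrite finset.inE => /eqP vi.
    by rewrite vi iS in vS.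
  have sumE w : (\sum_(i <- inl v :: sB ++ s | w \in W i) X i t =
      (if w == v then L v t + \sum_(j < n u) B v j t else 0) +
      \sum_(i <- s | w \in W i) X i t)%N.
    rewrite big_cons big_cat big_map /= finset.inE.
    case: eqP => wv; last by rewrite big_pred0_eq.
    by rewrite addnA big_mkord.
  split=> [h w|h].
    have NS w' : w' \in S -> N w' t = n w' by move=> w'S; apply: h; rewrite finset.setU1r.
    rewrite sumE; have /sN/(_ w) sw := NS; rewrite /restrict_count finset.in_setU1.
    case: eqP sw => /= [->|_ ->//]; rewrite s0 => _.
    by rewrite addn0 -(h v) ?finset.setU11// NvE /thinning (NS u uS) addnC.
  have NS w' : w' \in S -> N w' t = n w'.
    move: w'; apply/sN => w; have := h w; rewrite sumE /restrict_count finset.in_setU1.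
    by case: eqP => [->|//]; rewrite (negbTE vS) s0.
  move=> w; rewrite finset.in_setU1 => /orP[/eqP ->|]; last exact: NS.
  have := h v; rewrite sumE eqxx s0 addn0 /restrict_count finset.setU11 => <-.
  by rewrite NvE /thinning (NS u uS) addnC.
split.
- apply: uniq_grow => // Z; rewrite ssE => /andP[_ /fintype.subsetP ZS].
  by apply: contra vS; apply: ZS.
- by move=> Z; apply: subtrees_grow.
have ssS Z : Z \in ss -> Z \subset S by rewrite ssE => /andP[].
have vZ Z : Z \in map fst [seq (Z, gamma_in e lambda alpha S Z) | Z <- ss] -> v \notin Z.
  rewrite -map_comp => /mapP[Z' /ssS Z'S ->] /=.
  by apply: contra vS; apply/fintype.subsetP.
have vW Z : Z \in map fst [seq (W i, count_pmf P X i) | i <- s] -> v \notin Z.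
  rewrite -map_comp => /mapP[i /sD[_ iS] ->] /=; rewrite finset.inE.
  by apply: contraNneq vS => ->.
have nb w : (restrict_count n (v |: S)%SET w < b)%N.
  by rewrite /restrict_count; case: ifP => // _; exact: restrict_bound.
rewrite gamma_in_grow// -/theta /poisson_convolution /= map_cat -map_comp.
rewrite (pmf_poisson distL); apply: eq_bigr => k _; congr (_ * _).
(* With [k] points from the innovation, thinning must deliver the other n v - k points at [v]; the
   rest of the state is unchanged. *)
set n' := lower _ _ k.
have nb' w : (n' w < b)%N by rewrite (leq_ltn_trans (leq_subr _ _)).
have n'u : n' u = n u.
  by rewrite /n' /lower /restrict_count finset.in_set1 (negbTE uNv) subn0 finset.setU1r.
have kn' : kill n' v = restrict_count n S.
  apply: funext => w; rewrite /kill /n' /lower /restrict_count finset.in_set1 finset.in_setU1.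
  by case: eqP => [->|_]; rewrite ?(negbTE vS)//= subn0.
(* Both sides become the binomial weight of [n' v] among [n u] trials times a convolution on [S],
   and [convE] identifies the latter. *)
have := poisson_convolution_split theta uNv nb' vZ; rewrite /poisson_convolution => ->.
rewrite n'u kn' -[convolution b _ (restrict_count n S)]convE -kn'.
rewrite -(@convolution_bernoulli _ _ b _ _ _ (bernoulli_weight theta))//; last first.
  by case=> [|[]].
congr (convolution _ (_ ++ _) _).
rewrite (eq_map (_ : _ =1 fun=> ([set v]%SET, bernoulli_weight theta))).
  by rewrite /index_iota subn0; elim: (n u) 0%N => //= m ih j; rewrite ih.
by move=> j /=; rewrite (pmf_bernoulli (distB j)).
Qed.

End Construction.

(** For a boundary edge (i, j), admissibility bounds [alpha i j] by the square root of
    [lambda i / lambda j], the inverse of the root that multiplies it. *)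
Lemma gamma_ge0 (R : realType) (d : nat) (e : rel 'I_d)
    (lambda : 'I_d -> R) (alpha : 'I_d -> 'I_d -> R) (W : {set 'I_d}) :
  admissible e lambda alpha -> 0 <= gamma e lambda alpha W.
Proof.
move=> [lambda_gt0 _ alphaB]; rewrite /gamma !mulr_ge0//.
- by apply: prodr_ge0 => v _; apply: ltW.
- apply: prodr_ge0 => -[i j]; rewrite finset.inE /= => /and4P[ij _ _ _].
  by rewrite divr_ge0 ?sqrtr_ge0//; have /andP[/ltW] := alphaB _ _ ij.
apply: prodr_ge0 => -[i j]; rewrite finset.inE /= => /and3P[ij _ _].
have /andP[a0] := alphaB _ _ ij; rewrite le_min => /andP[a1 _].
rewrite subr_ge0; apply: le_trans (ler_wpM2r (sqrtr_ge0 _) a1) _.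
have [li lj] := (lambda_gt0 i, lambda_gt0 j).
have ratio_ge0 : 0 <= lambda i / lambda j by rewrite divr_ge0 ?ltW.
rewrite -sqrtrM// -[lambda j / _]invf_div divff ?sqrtr1//.
by rewrite mulf_neq0 ?invr_eq0 ?gt_eqF.
Qed.

Section SubtreeSum.
Context (R : realType) (d : nat) (e : rel 'I_d).
Context (lambda : 'I_d -> R) (alpha : 'I_d -> 'I_d -> R).
Context (disp : measure_display) (T : measurableType disp).
Context (P : probability T R) (Y : {set 'I_d} -> {RV P >-> nat}).
Hypothesis familyY : poisson_family e lambda alpha Y.
Context (ss : seq {set 'I_d}).
Hypotheses (us : uniq ss) (ssE : forall W, (W \in ss) = (W \in subtrees e)).

Lemma subtree_sum_event n :
  [set t | (fun v => subtree_sum e (fun W => Y W) v t) = n]%classic =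
  sum_event (fun W => Y W : T -> nat) id ss n.
Proof.
have sumE v t : subtree_sum e (fun W => Y W) v t =
    (\sum_(W <- ss | v \in W) Y W t)%N.
  rewrite /subtree_sum -big_enum -[RHS]big_filter; apply: perm_big.
  apply: uniq_perm; [exact: enum_uniq|exact: filter_uniq|move=> W].
  rewrite mem_enum mem_filter ssE in_subtrees in_Theta.
  have [vW|//] := boolP (v \in W); rewrite (_ : W != _)//.
  by apply/finset.set0Pn; exists v.
apply/seteqP; split=> t /=; first by move=> nE v; rewrite -nE sumE.
by move=> h; apply: funext => v; rewrite sumE; exact: h.
Qed.

Let mY W A : [set` subtrees e]%classic W -> measurable (Y W @^-1` A)%classic.
Proof.
by move=> _; rewrite -[X in measurable X]setTI; exact: measurable_funP.
Qed.

Let ss0 W : W \in ss -> id W != finset.set0.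
Proof. by rewrite ssE in_subtrees => /andP[]. Qed.

Lemma measurable_subtree_sum n :
  measurable [set t | (fun v => subtree_sum e (fun W => Y W) v t) = n]%classic.
Proof.
rewrite subtree_sum_event.
apply: (measurable_sum_event (D := [set` subtrees e]%classic)
  (B := (\sum_w n w).+1)) => //.
- by move=> W; rewrite ssE.
- exact: restrict_bound.
Qed.

Lemma pmf_subtree_sum n :
  P [set t | (fun v => subtree_sum e (fun W => Y W) v t) = n]%classic =
  (poisson_convolution (\sum_w n w).+1
     [seq (W, gamma e lambda alpha W) | W <- ss] n)%:E.
Proof.
have [indY distY] := familyY.
rewrite subtree_sum_event.
rewrite (probability_sum_event (D := [set` subtrees e]%classic)
  (B := (\sum_w n w).+1))//.
- congr (convolution _ _ _)%:E; rewrite -map_comp; apply/eq_in_map => W.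
  rewrite ssE => /distY[g0 h] /=; congr pair; apply: funext => k.
  by have := h [set k]%classic; rewrite poisson_prob_set1// => hk;
    rewrite /count_pmf [X in fine X]hk.
- by move=> W; rewrite ssE.
- exact: restrict_bound.
Qed.

End SubtreeSum.

(* The second conjunct says that every independent Poisson family with the
   stated parameters yields the representation, the first that one exists. *)
Theorem proposition2p7 (R : realType) (d : nat) (e : rel 'I_d)
    (lambda : 'I_d -> R) (alpha : 'I_d -> 'I_d -> R)
    (disp : measure_display) (T : measurableType disp) (P : probability T R)
    (N : 'I_d -> {RV P >-> nat}) :
  is_tree e -> admissible e lambda alpha -> is_MPMRF e lambda alpha N ->
  (exists (disp' : measure_display) (T' : measurableType disp')
      (P' : probability T' R) (Y : {set 'I_d} -> {RV P' >-> nat}),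
      poisson_family e lambda alpha Y /\
      same_law P N P' (subtree_sum e (fun W => Y W)))
  /\
  (forall (disp' : measure_display) (T' : measurableType disp')
      (P' : probability T' R) (Y : {set 'I_d} -> {RV P' >-> nat}),
      poisson_family e lambda alpha Y ->
      same_law P N P' (subtree_sum e (fun W => Y W))).
Proof.
move=> treeE admE [r [disp1 [T1 [P1 [L [B [N1 [constr law1]]]]]]]].
have same disp' (T' : measurableType disp') (P' : probability T' R)
    (Y : {set 'I_d} -> {RV P' >-> nat}) : poisson_family e lambda alpha Y ->
    same_law P N P' (subtree_sum e (fun W => Y W)).
  move=> familyY; apply: same_law_atoms => n.
  - rewrite (_ : mkset _ = \bigcap_(v in [set: 'I_d]) (N v @^-1` [set n v]))%classic.
      apply: fin_bigcap_measurable => // v _.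
      by rewrite -[X in measurable X]setTI; exact: measurable_funP.
    apply/seteqP; split=> t /=; first by move=> <- v _.
    by move=> h; apply: funext => v; apply: h.
  - apply: (measurable_subtree_sum Y (enum_uniq (subtrees e))) => W.
    by rewrite mem_enum.
  have [ss [us ssE pmfN]] := pmf_construction treeE admE constr n.
  (* Measurability of the constructed vector is not assumed; its law is only used on a singleton. *)
  have -> := law1 [set m | m = n]%classic.
  by rewrite /= (pmf_subtree_sum familyY us ssE).
split=> //.
have [|disp' [T' [P' [Y [indY distY]]]]] :=
    @independent_poisson_exists R _ (gamma e lambda alpha) (enum (subtrees e))
      (enum_uniq _).
  by move=> W _; exact: gamma_ge0.
have enumE : [set` enum (subtrees e)]%classic = [set` subtrees e]%classic.
  by apply/seteqP; split=> W /=; rewrite mem_enum.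
have familyY : poisson_family e lambda alpha Y.
  by rewrite /poisson_family -enumE; split=> // W WE; apply: distY; rewrite mem_enum.
by exists disp', T', P', Y; split=> //; exact: same.
Qed.
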